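(* Let $F_{\underline{213}}(x,t)=\sum_{n\ge0}\sum_{\pi\in\mathbf S_n(132,\underline{123})}x^nt^{\mathrm{occ}_{213}(\pi)}$. Then $aF_{\underline{213}}^2+bF_{\underline{213}}+1=0$, where $a=x^2t$ and $b=-1+x+x^2-x^2t$.
   Context: $\mathbf S_n(132,\underline{123})$ is the set of $\pi\in\mathbf S_n$ with no subsequence order-isomorphic to $132$ and no three consecutive entries order-isomorphic to $123$. $\mathrm{occ}_{213}(\pi)$ is the number of indices $i$ such that $\pi_i\pi_{i+1}\pi_{i+2}$ is order-isomorphic to $213$. *)

(* Defs.v *)
From HB Require Import structures.
From mathcomp Require Import all_boot all_order all_fingroup all_algebra.
From mathcomp Require Import boolp.

Set Implicit Arguments.
Unset Strict Implicit.
Unset Printing Implicit Defensive.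

Import GRing.Theory.

Definition order_iso (u v : seq nat) : bool :=
  (size u == size v) &&
  [forall i : 'I_(size u), forall j : 'I_(size u),
     (nth 0 u i < nth 0 u j) == (nth 0 v i < nth 0 v j)].

(* The subsequences of w are exactly the [mask m w]; see [avoidsP]. *)
Definition avoids (p w : seq nat) : bool :=
  [forall m : (size w).-tuple bool, ~~ order_iso (mask m w) p].

(* Number of factors (blocks of consecutive letters) of w order-isomorphic to p.
   A window sticking out of w is truncated, hence too short to match p. *)
Definition occ (p w : seq nat) : nat :=
  count (fun i => order_iso (take (size p) (drop i w)) p) (iota 0 (size w)).

Definition avoids_consecutive (p w : seq nat) : bool := occ p w == 0.

(* One-line notation, with letters 0, ..., n-1 instead of 1, ..., n. *)
Definition word n (s : 'S_n) : seq nat := [seq val (s i) | i <- enum 'I_n].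

Definition S_132_123 n : {set 'S_n} :=
  [set s : 'S_n | avoids [:: 1; 3; 2] (word s)
                & avoids_consecutive [:: 1; 2; 3] (word s)].

Definition occ_213 n (s : 'S_n) : nat := occ [:: 2; 1; 3] (word s).

Lemma avoidsP (p w : seq nat) :
  reflect (forall u, subseq u w -> ~~ order_iso u p) (avoids p w).
Proof.
apply: (iffP forallP) => [H u /subseqP [m sz_m ->] | H m].
  by have := H (@Tuple _ _ m (introT eqP sz_m)).
exact/H/mask_subseq.
Qed.

Local Open Scope ring_scope.

(* Formal power series over R, given by their sequence of coefficients. *)
Definition fps (R : Type) : Type := nat -> R.

Section FormalPowerSeries.
Variable R : comNzRingType.
Implicit Types f g h : fps R.

Definition fps_zero : fps R := fun=> 0.
Definition fps_opp f : fps R := fun n => - f n.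
Definition fps_add f g : fps R := fun n => f n + g n.
Definition fpsC (c : R) : fps R := fun n => if n is 0 then c else 0.
Definition fpsX : fps R := fun n => (n == 1%N)%:R.
Definition fps_mul f g : fps R := fun n => \sum_(i < n.+1) f i * g (n - i)%N.

Lemma fps_addA : associative fps_add.
Proof. by move=> f g h; apply/funext => n; rewrite /fps_add addrA. Qed.

Lemma fps_addC : commutative fps_add.
Proof. by move=> f g; apply/funext => n; rewrite /fps_add addrC. Qed.

Lemma fps_add0 : left_id fps_zero fps_add.
Proof. by move=> f; apply/funext => n; rewrite /fps_add add0r. Qed.

Lemma fps_addN : left_inverse fps_zero fps_opp fps_add.
Proof. by move=> f; apply/funext => n; rewrite /fps_add addNr. Qed.

Lemma fps_mulE f g (p q : {poly R}) n :
    (forall i, (i <= n)%N -> f i = p`_i) ->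
    (forall i, (i <= n)%N -> g i = q`_i) ->
  fps_mul f g n = (p * q)`_n.
Proof.
move=> fp gq; rewrite coefM; apply: eq_bigr => i _.
by rewrite fp ?gq ?leq_subr // -ltnS.
Qed.

Let trunc f n : {poly R} := \poly_(i < n.+1) f i.

Let truncE f n i : (i <= n)%N -> f i = (trunc f n)`_i.
Proof. by move=> le_in; rewrite coef_poly ltnS le_in. Qed.

Let truncM f g n i : (i <= n)%N -> fps_mul f g i = (trunc f n * trunc g n)`_i.
Proof. by move=> le_in; apply: fps_mulE => j /leq_trans/(_ le_in); apply: truncE. Qed.

Lemma fps_mulC : commutative fps_mul.
Proof. by move=> f g; apply/funext => n; rewrite !(@truncM _ _ n) // mulrC. Qed.

Lemma fps_mulA : associative fps_mul.
Proof.
move=> f g h; apply/funext => n.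
rewrite (fps_mulE (@truncE f n) (@truncM g h n)) mulrA.
by rewrite -(fps_mulE (@truncM f g n) (@truncE h n)).
Qed.

Lemma fps_mul1 : left_id (fpsC 1) fps_mul.
Proof.
move=> f; apply/funext => n.
by rewrite /fps_mul big_ord_recl big1 ?addr0 ?subn0 ?mul1r // => i _; rewrite mul0r.
Qed.

Lemma fps_mulDl : left_distributive fps_mul fps_add.
Proof.
move=> f g h; apply/funext => n; rewrite /fps_mul /fps_add -big_split /=.
by apply: eq_bigr => i _; rewrite mulrDl.
Qed.


End FormalPowerSeries.

HB.instance Definition _ (R : Type) := gen_eqMixin (fps R).
HB.instance Definition _ (R : Type) := gen_choiceMixin (fps R).
HB.instance Definition _ (R : comNzRingType) := GRing.isZmodule.Build (fps R)
  (@fps_addA R) (@fps_addC R) (@fps_add0 R) (@fps_addN R).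

Lemma fps_oner_neq0 (R : comNzRingType) : fpsC 1 != 0 :> fps R.
Proof. by apply/eqP => /(congr1 (@^~ 0%N))/eqP; rewrite oner_eq0. Qed.

HB.instance Definition _ (R : comNzRingType) :=
  GRing.Zmodule_isComNzRing.Build (fps R) (@fps_mulA R) (@fps_mulC R)
    (@fps_mul1 R) (@fps_mulDl R) (@fps_oner_neq0 R).

(* The series F in Z[t][[x]]: the coefficient of x^n is a polynomial in t,
   and 'X stands for t. *)
Definition F_213 : fps {poly int} :=
  fun n => \sum_(s in S_132_123 n) 'X ^+ occ_213 s.

(* Main.v *)
Require Import Defs.
From mathcomp Require Import all_boot all_order all_fingroup all_algebra.
From mathcomp Require Import boolp ring zify.

(** Write a 132-avoiding word as A m B with m its maximum; avoidance forces every
letter of A above every letter of B.  The word avoids consecutive 123 iff A and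
B do and A does not end in an ascent, and m creates a new consecutive 213 iff A
ends in a descent.  Hence F = 1 + x G F, where G counts the admissible A.  A
132-avoiding word ending in a descent ends in its minimum, and deleting this
minimum changes no occurrence, so G = 1 + x + x t (F - 1). *)

Set Implicit Arguments.
Unset Strict Implicit.
Unset Printing Implicit Defensive.

Import GRing.Theory.

(** * Recursive tests for the three patterns *)

Definition r132 a b c := (a < c) && (c < b).
Definition r123 a b c := (a < b) && (b < c).
Definition r213 a b c := (b < a) && (a < c).

Fixpoint av132 (w : seq nat) : bool :=
  if w is a :: w' then pairwise (fun b c => ~~ r132 a b c) w' && av132 w'
  else true.

Fixpoint occ3 (r : nat -> nat -> nat -> bool) (w : seq nat) : nat :=
  if w is a :: w' then
    (if w' is b :: c :: _ then r a b c else false) + occ3 r w'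
  else 0.

(** The last two letters are compared in their order in [w]. Words with fewer than two letters end
    neither in an ascent nor in a descent, which produces the terms 1 + x of G. *)
Definition ends_with (e : rel nat) (w : seq nat) : bool :=
  if rev w is b :: a :: _ then e a b else false.

Local Notation ends_asc := (ends_with ltn).
Local Notation ends_desc := (ends_with (fun a b => b < a)).

Definition valid (w : seq nat) : bool := av132 w && (occ3 r123 w == 0).

(** Diagonal comparisons are false on both sides, so only the six comparisons between distinct
    positions remain. This makes each concrete pattern a matter for [lia]. *)
Lemma order_iso3 (u p : seq nat) : size p = 3 ->
  order_iso u p =
  if u is [:: a; b; c] then
    [&& (a < b) == (nth 0 p 0 < nth 0 p 1), (b < a) == (nth 0 p 1 < nth 0 p 0),
        (a < c) == (nth 0 p 0 < nth 0 p 2), (c < a) == (nth 0 p 2 < nth 0 p 0),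
        (b < c) == (nth 0 p 1 < nth 0 p 2) & (c < b) == (nth 0 p 2 < nth 0 p 1)]
  else false.
Proof.
rewrite /order_iso => ->; case: u => [|a [|b [|c [|d u]]]] //=.
apply/forallP/and5P => [H|[H1 H2 H3 H4 /andP[H5 H6]] i].
  have h i j : (i < 3) -> (j < 3) ->
      (nth 0 [:: a; b; c] i < nth 0 [:: a; b; c] j) == (nth 0 p i < nth 0 p j).
    by move=> li lj; have /forallP/(_ (Ordinal lj)) := H (Ordinal li).
  split; [exact: (h 0 1) | exact: (h 1 0) | exact: (h 0 2) | exact: (h 2 0) |].
  by apply/andP; split; [exact: (h 1 2) | exact: (h 2 1)].
apply/forallP => j; case: i j => [[|[|[|i]]] li] [[|[|[|j]]] lj] //=;
  by rewrite !ltnn.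
Qed.

Lemma order_iso_132 u :
  order_iso u [:: 1; 3; 2] = if u is [:: a; b; c] then r132 a b c else false.
Proof.
by rewrite order_iso3 //; case: u => [|a [|b [|c [|]]]] //=; rewrite /r132; lia.
Qed.

Lemma order_iso_123 u :
  order_iso u [:: 1; 2; 3] = if u is [:: a; b; c] then r123 a b c else false.
Proof.
by rewrite order_iso3 //; case: u => [|a [|b [|c [|]]]] //=; rewrite /r123; lia.
Qed.

Lemma order_iso_213 u :
  order_iso u [:: 2; 1; 3] = if u is [:: a; b; c] then r213 a b c else false.
Proof.
by rewrite order_iso3 //; case: u => [|a [|b [|c [|]]]] //=; rewrite /r213; lia.
Qed.

Lemma occE (p : seq nat) (r : nat -> nat -> nat -> bool) w :
    size p = 3 ->
    (forall u, order_iso u p = if u is [:: a; b; c] then r a b c else false) ->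
  occ p w = occ3 r w.
Proof.
(* The windows of [a :: w] starting at positions 1, 2, ... are those of [w]; only the window at
   position 0 is new. *)
rewrite /occ => -> isoE; elim: w => //= a w <-; congr (_ + _); last first.
  by rewrite -[1]addn0 iotaDl count_map.
by rewrite isoE; case: w => [|b [|c w]] //=; rewrite take0.
Qed.

Lemma pairwise_subseqP (T : eqType) (r : rel T) (w : seq T) :
  reflect (forall b c, subseq [:: b; c] w -> r b c) (pairwise r w).
Proof.
apply: (iffP idP) => [rw b c /subseq_pairwise/(_ rw) /=|].
  by rewrite !andbT.
elim: w => //= a w IHw H; apply/andP; split.
  by apply/allP => c cw; apply: H; rewrite eqxx sub1seq.
apply: IHw => b c bcw; apply: H; case: eqP => // _.
by apply: subseq_trans bcw; apply: subseq_cons.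
Qed.

Lemma av132P w :
  reflect (forall a b c, subseq [:: a; b; c] w -> ~~ r132 a b c) (av132 w).
Proof.
elim: w => [|x w IHw]; first by apply: ReflectT.
apply: (iffP andP) => [[/pairwise_subseqP pw /IHw av] a b c|H].
  rewrite [subseq _ _]/=; case: eqP => [-> |_]; first exact: pw.
  exact: av.
split; first by apply/pairwise_subseqP => b c bcw; apply: H; rewrite /= eqxx.
apply/IHw => a b c abcw; apply: H.
by apply: subseq_trans abcw _; apply: subseq_cons.
Qed.

Lemma avoids_132E w : avoids [:: 1; 3; 2] w = av132 w.
Proof.
apply/avoidsP/av132P => [H a b c /H|H u uw]; first by rewrite order_iso_132.
rewrite order_iso_132; case: u uw => [|a [|b [|c [|]]]] //; exact: H.
Qed.

Lemma validE w :
  avoids [:: 1; 3; 2] w && avoids_consecutive [:: 1; 2; 3] w = valid w.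
Proof.
by rewrite avoids_132E /avoids_consecutive (occE _ _ order_iso_123).
Qed.

(** * Decomposition of a word around its maximum *)

Lemma ends_with_rcons2 e w a b : ends_with e (rcons (rcons w a) b) = e a b.
Proof. by rewrite /ends_with !rev_rcons. Qed.

Lemma seq_rcons2P (T : Type) (w : seq T) :
  1 < size w -> exists u a b, w = rcons (rcons u a) b.
Proof.
case/lastP: w => // w b; case/lastP: w => // u a _.
by exists u, a, b.
Qed.

Lemma occ3_rcons3 r w a b c :
  occ3 r (rcons (rcons (rcons w a) b) c) =
  occ3 r (rcons (rcons w a) b) + r a b c.
Proof.
elim: w => [|x w IHw]; first by rewrite /= !addn0.
rewrite !rcons_cons [LHS]/= IHw [in RHS]/= addnA; congr (_ + _ + _).
by case: w {IHw} => [|y [|z w]].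
Qed.

(** Appending [m] creates a single new window, made of the last two letters of [w] and [m]. When [m]
    is extremal, whether it matches depends only on the order [e] of those two letters. *)
Lemma occ3_rcons r e w m :
    (forall a b, a \in w -> b \in w -> r a b m = e a b) ->
  occ3 r (rcons w m) = occ3 r w + ends_with e w.
Proof.
case/lastP: w => // w b; case/lastP: w => // w a rE.
by rewrite occ3_rcons3 ends_with_rcons2 rE // !(mem_rcons, inE) eqxx ?orbT.
Qed.

(** A window with [m] in first or middle place would need a later letter above [m], and all letters
    of [B] are smaller. The windows left lie in [rcons A m] or in [B]. *)
Lemma occ3_cat_max (r : nat -> nat -> nat -> bool) A m B :
    (forall a b, r m a b -> m < b \/ m < a) -> (forall a b, r a m b -> m < b) ->
    all (gtn m) B ->
  occ3 r (A ++ m :: B) = occ3 r (rcons A m) + occ3 r B.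
Proof.
move=> rm rm' Bm; elim: A => [|a A IHA].
  rewrite /=; case: B Bm => [|b [|c B]] //= /and3P[bm cm _].
  by case: (boolP (r m b c)) => // /rm; lia.
rewrite rcons_cons !cat_cons [LHS]/= IHA [in RHS]/= addnA; congr (_ + _ + _).
case: A {IHA} => [|a' [|a'' A]] //=.
case: B Bm => [|b B] //= /andP[bm _].
by case: (boolP (r a m b)) => // /rm'; lia.
Qed.

(** For [a] in [A] and [b] in [B], the letters [a m b] form a 132 unless [b < a]. Conversely, once
    [A] lies above [B], no 132 can start in [A] and end in [B], and [m] can be neither the 1 nor the
    2 of a 132. *)
Lemma av132_cat_max A m B :
    uniq (A ++ m :: B) -> all (gtn m) A -> all (gtn m) B ->
  av132 (A ++ m :: B) = [&& allrel (fun a b => b < a) A B, av132 A & av132 B].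
Proof.
elim: A => [|a A IHA] /=.
  move=> _ _ /allP Bm; rewrite (_ : pairwise _ B) //.
  apply/pairwise_subseqP => b c /mem_subseq/(_ c).
  by rewrite !inE eqxx orbT => /(_ isT)/Bm; rewrite /r132 /=; lia.
move=> /andP[aU U] /andP[am Am] Bm; rewrite IHA //.
rewrite /allrel /= -/(allrel _ A B) pairwise_cat.
have [aB|] := boolP (all _ B); last first.
  (* A letter [b] of [B] that is not below [a] differs from [a] by uniqueness, so [a m b] is a
     132. *)
  rewrite /= => /allPn [b bB ab]; apply/negbTE/negP.
  case/andP => /and3P[_ _ /=/andP[/allP/(_ b bB)]] + _ _.
  have := allP Bm b bB; move: aU; rewrite mem_cat inE !negb_or.
  case/and3P=> _ _ aB; have: a != b by apply: contraNneq aB => ->.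
  by rewrite /r132 /=; lia.
have -> : allrel (fun b c => ~~ r132 a b c) A (m :: B).
  apply/allrelP => a' b /(allP Am) /= a'm; rewrite inE /r132.
  case/predU1P=> [->|/(allP aB) /= ba].
    by rewrite [m < _]ltnNge (ltnW a'm) andbF.
  by rewrite ltnNge ltnW.
have -> : pairwise (fun b c => ~~ r132 a b c) (m :: B).
  apply/pairwise_subseqP => b c /mem_subseq sub.
  have := sub c; have := sub b; rewrite !inE !eqxx !orbT /r132.
  move=> /(_ isT)/predU1P hb /(_ isT)/predU1P [->|/(allP aB) /= ca]; last first.
    by rewrite ltnNge ltnW.
  case: hb => [->|/(allP Bm) /= bm]; first by rewrite ltnn andbF.
  by rewrite [m < _]ltnNge (ltnW bm) andbF.
by rewrite /= !andbT; case: (pairwise _ A); rewrite //= andbF.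
Qed.

Lemma valid_cat_max A m B :
    uniq (A ++ m :: B) -> all (gtn m) A -> all (gtn m) B ->
  valid (A ++ m :: B) =
  [&& allrel (fun a b => b < a) A B, valid A, ~~ ends_asc A & valid B].
Proof.
move=> U Am Bm; rewrite /valid av132_cat_max // occ3_cat_max ?/r123 //.
- rewrite (@occ3_rcons _ ltn) => [|a b aA bA]; last first.
    by have := allP Am _ bA; rewrite /r123 /=; lia.
  rewrite !addn_eq0 eqb0; case: (allrel _ _ _); case: (av132 A) => //=.
  by case: (ends_asc A); rewrite ?andbF // andbT andbCA.
- by move=> a b; lia.
- by move=> a b; lia.
Qed.

Lemma occ3_213_cat_max A m B :
    all (gtn m) A -> all (gtn m) B ->
  occ3 r213 (A ++ m :: B) = occ3 r213 A + ends_desc A + occ3 r213 B.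
Proof.
move=> Am Bm; rewrite occ3_cat_max ?/r213 //; try by move=> a b; lia.
congr (_ + _); apply: occ3_rcons => a b aA bA.
by have := allP Am _ aA; rewrite /r213 /=; lia.
Qed.

(** * Invariance under adding a constant to all letters *)

Section Shift.
Variable k : nat.

Lemma av132_shift w : av132 (map (addn k) w) = av132 w.
Proof.
elim: w => //= a w ->; rewrite pairwise_map; congr (_ && _).
by apply: eq_pairwise => b c; rewrite /= /r132 !ltn_add2l.
Qed.

Lemma occ3_shift r w :
    (forall a b c, r (k + a) (k + b) (k + c) = r a b c) ->
  occ3 r (map (addn k) w) = occ3 r w.
Proof.
by move=> rE; elim: w => //= a w ->; case: w => [|b [|c w]] //=; rewrite rE.
Qed.

Lemma ends_with_shift (e : rel nat) w :
    (forall a b, e (k + a) (k + b) = e a b) ->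
  ends_with e (map (addn k) w) = ends_with e w.
Proof.
by move=> eE; rewrite /ends_with -map_rev; case: (rev w) => [|b [|a u]] /=.
Qed.

Lemma valid_shift w : valid (map (addn k) w) = valid w.
Proof.
rewrite /valid av132_shift occ3_shift // => a b c.
by rewrite /r123 !ltn_add2l.
Qed.

Lemma occ3_213_shift w : occ3 r213 (map (addn k) w) = occ3 r213 w.
Proof. by apply: occ3_shift => a b c; rewrite /r213 !ltn_add2l. Qed.

Lemma ends_asc_shift w : ends_asc (map (addn k) w) = ends_asc w.
Proof. by apply: ends_with_shift => a b /=; rewrite ltn_add2l. Qed.

Lemma ends_desc_shift w : ends_desc (map (addn k) w) = ends_desc w.
Proof. by apply: ends_with_shift => a b /=; rewrite ltn_add2l. Qed.

End Shift.

(** * Valid permutations as lists, grouped by the position of the maximum *)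

Definition words n := [seq w <- permutations (iota 0 n) | valid w].

Lemma words_uniq n : uniq (words n).
Proof. by rewrite filter_uniq // permutations_uniq. Qed.

Lemma mem_words n w : (w \in words n) = valid w && perm_eq w (iota 0 n).
Proof. by rewrite mem_filter mem_permutations. Qed.

(** As [B] lies below [A], sorting each block makes [B ++ A] a sorted permutation of [iota 0 n],
    hence [iota 0 n] itself. Cutting it after [size B] letters identifies both blocks. *)
Lemma perm_iota_split n A B :
    perm_eq (A ++ B) (iota 0 n) -> allrel (fun a b => b < a) A B ->
  perm_eq A (iota (size B) (size A)) /\ perm_eq B (iota 0 (size B)).
Proof.
move=> AB /allrelP gtAB.
have n_def : n = size B + size A.
  by rewrite addnC -size_cat (perm_size AB) size_iota.
have : sort leq B ++ sort leq A = iota 0 (size B) ++ iota (size B) (size A).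
  rewrite -[in iota (size B) _](add0n (size B)) -iotaD -n_def.
  apply: (@sorted_eq _ leq leq_trans anti_leq); last 2 first.
  - exact: iota_sorted.
  - rewrite -(permPr AB) perm_catC; apply: perm_cat; exact/permPl/perm_sort.
  rewrite sorted_pairwise; last exact: leq_trans.
  rewrite pairwise_cat -!sorted_pairwise; try exact: leq_trans.
  rewrite !sort_sorted; try exact: leq_total.
  rewrite !andbT; apply/allrelP => b a; rewrite !mem_sort => bB aA.
  exact/ltnW/gtAB.
move/eqP; rewrite eqseq_cat ?size_sort ?size_iota // => /andP[/eqP <- /eqP <-].
by rewrite !(perm_sym _ (sort _ _)) !perm_sort.
Qed.

(** Inverse of the splitting at the maximum [n]: [A] is kept standardized, with letters from 0, and
    is lifted above [B] by taking for [k] the size of [B]. *)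
Definition glue n k (A B : seq nat) := map (addn k) A ++ n :: B.

Lemma index_glue n A B (i := size A) (k := n - i) :
    i <= n -> perm_eq A (iota 0 i) -> index n (glue n k A B) = i.
Proof.
move=> le_in pA; rewrite /glue index_cat size_map /= eqxx addn0 ifN //.
apply/mapP => -[a]; rewrite (perm_mem pA) mem_iota /k; lia.
Qed.

Lemma glue_hyps n A B (i := size A) (k := n - i) :
    i <= n -> perm_eq A (iota 0 i) -> perm_eq B (iota 0 k) ->
  [/\ perm_eq (glue n k A B) (iota 0 n.+1), all (gtn n) (map (addn k) A),
      all (gtn n) B & allrel (fun a b => b < a) (map (addn k) A) B].
Proof.
move=> le_in pA pB; split.
- rewrite /glue -cat1s perm_catCA -addn1 iotaD add0n perm_sym perm_catC /=.
  rewrite perm_cons perm_sym perm_catC.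
  have -> : iota 0 n = iota 0 k ++ iota k i.
    by rewrite -[k in iota k i]add0n -iotaD subnK.
  by apply: perm_cat => //; rewrite -[in iota k i](addn0 k) iotaDl perm_map.
- apply/allP => _ /mapP[a + ->]; rewrite (perm_mem pA) mem_iota /= /k; lia.
- apply/allP => b; rewrite (perm_mem pB) mem_iota /= /k; lia.
- apply/allrelP => _ b /mapP[a _ ->]; rewrite (perm_mem pB) mem_iota /= ; lia.
Qed.

(** Cutting at the maximum and standardizing the left block is a bijection with inverse [glue]: the
    position [i] fixes both block sizes, hence by [perm_iota_split] both sets of letters. *)
Lemma words_index n i : i <= n ->
  perm_eq [seq w <- words n.+1 | index n w == i]
    [seq glue n (n - i) A B | A <- [seq A <- words i | ~~ ends_asc A],
                              B <- words (n - i)].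
Proof.
move=> le_in; apply: uniq_perm.
- exact/filter_uniq/words_uniq.
- apply: allpairs_uniq; [exact/filter_uniq/words_uniq | exact: words_uniq |].
  move=> [A B] [A' B'] /allpairsP[[A1 B1] /= [+ _ [-> ->]]].
  rewrite mem_filter mem_words => /and3P[_ _ /perm_size sA1].
  move=> /allpairsP[[A2 B2] /= [+ _ [-> ->]]].
  rewrite mem_filter mem_words => /and3P[_ _ /perm_size sA2] /eqP.
  (* Both left blocks have length [i], so equal glued words agree block by block. *)
  rewrite /glue eqseq_cat ?size_map ?sA1 ?sA2 // eqseq_cons eqxx /=.
  by case/andP => /eqP/(inj_map (@addnI _)) -> /eqP ->.
move=> w; rewrite mem_filter mem_words.
apply/and3P/allpairsP => [[/eqP iw vw pw]|[[A B] /= [+ + ->]]].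
  have nw : n \in w by rewrite (perm_mem pw) mem_iota leq0n /=.
  have Uw : uniq w by rewrite (perm_uniq pw) iota_uniq.
  have sw : size w = n.+1 by rewrite (perm_size pw) size_iota.
  have w_def : w = take i w ++ n :: drop i.+1 w.
    by rewrite -[in LHS](cat_take_drop i w) (drop_nth 0) ?sw // -iw nth_index.
  have sA : size (take i w) = i by rewrite size_takel ?sw //; lia.
  have sB : size (drop i.+1 w) = n - i by rewrite size_drop sw; lia.
  move: w_def sA sB; set A := take i w; set B := drop _ w => w_def sA sB.
  have pAB : perm_eq (A ++ B) (iota 0 n).
    have: perm_eq ([:: n] ++ A ++ B) ([:: n] ++ iota 0 n).
      rewrite perm_catCA -w_def (permPl pw) perm_sym perm_catC.
      by rewrite -addn1 iotaD.
    by rewrite perm_cat2l.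
  have ltn_AB : all (gtn n) (A ++ B).
    by rewrite (perm_all _ pAB); apply/allP => a; rewrite mem_iota.
  move: ltn_AB vw Uw; rewrite w_def all_cat => /andP[An Bn] + Uw.
  rewrite valid_cat_max // => /and4P[gtAB vA nA vB].
  have [] := perm_iota_split pAB gtAB; rewrite sA sB => pA pB.
  (* The letters of [A] are at least [n - i], so the truncated subtraction loses nothing. *)
  have A_def : A = map (addn (n - i)) (map (subn^~ (n - i)) A).
    rewrite -map_comp map_id_in // => a; rewrite (perm_mem pA) mem_iota.
    by case/andP => le_a _; apply: subnKC.
  exists (map (subn^~ (n - i)) A, B) => /=; split.
  - rewrite mem_filter mem_words -(ends_asc_shift (n - i)).
    rewrite -(valid_shift (n - i)) -A_def nA vA /=.
    have -> : iota 0 i = map (subn^~ (n - i)) (iota (n - i) i).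
      rewrite -{2}[n - i]addn0 iotaDl -map_comp map_id_in // => a _ /=.
      by rewrite addKn.
    exact: perm_map.
  - by rewrite mem_words vB.
  - by rewrite /glue -A_def.
rewrite mem_filter !mem_words => /and3P[nA vA pA] /andP[vB pB].
have sA : size A = i by rewrite (perm_size pA) size_iota.
move: le_in pA pB; rewrite -sA => le_in pA pB.
have [pg An Bn gtAB] := glue_hyps le_in pA pB.
split=> //; first by rewrite index_glue.
have Ug : uniq (glue n (n - size A) A B) by rewrite (perm_uniq pg) iota_uniq.
by rewrite valid_cat_max // gtAB valid_shift vA ends_asc_shift nA.
Qed.

(** * Words ending in their minimum *)

Section AppendMin.
Variables (w : seq nat) (m : nat).
Hypothesis mw : all (ltn m) w.

(** The new last letter could only be the 2 of a 132, and would then have to exceed the 1. *)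
Lemma av132_rcons_min : av132 (rcons w m) = av132 w.
Proof.
elim: w mw => //= a u IHu /andP[ma mu]; rewrite IHu // pairwise_rcons.
congr (_ && _); rewrite (_ : all _ u) //.
by apply/allP => b _; rewrite /r132 ltnNge (ltnW ma).
Qed.

(** The hypothesis holds for 123 and for 213, whose last letter exceeds an earlier one; a final
    minimum completes neither. *)
Lemma occ3_rcons_min (r : nat -> nat -> nat -> bool) :
  (forall a b, r a b m -> a < m \/ b < m) -> occ3 r (rcons w m) = occ3 r w.
Proof.
move=> rm; rewrite (@occ3_rcons _ (fun _ _ => false)) => [|a b aw bw].
  by rewrite /ends_with; case: (rev w) => [|? []]; rewrite addn0.
apply/negP => /rm; have := allP mw _ aw; have := allP mw _ bw => /=; lia.
Qed.

Lemma valid_rcons_min : valid (rcons w m) = valid w.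
Proof.
rewrite /valid av132_rcons_min occ3_rcons_min // => a b; rewrite /r123; lia.
Qed.

Lemma occ3_213_rcons_min : occ3 r213 (rcons w m) = occ3 r213 w.
Proof. by apply: occ3_rcons_min => a b; rewrite /r213; lia. Qed.

Lemma ends_desc_rcons_min : w != [::] -> ends_desc (rcons w m).
Proof.
case/lastP: w mw => // u a; rewrite all_rcons ends_with_rcons2.
by case/andP.
Qed.

End AppendMin.

(** If 0 stood before the final descent [a b], then [0 a b] would be a 132 unless [b] is 0; and [a]
    cannot be 0, being above [b]. *)
Lemma last_min n w a b :
    perm_eq (rcons (rcons w a) b) (iota 0 n.+1) ->
    av132 (rcons (rcons w a) b) -> b < a ->
  b = 0.
Proof.
move=> pw /av132P av ba.
have: 0 \in rcons (rcons w a) b by rewrite (perm_mem pw) mem_iota.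
rewrite !(mem_rcons, inE) => /or3P[/eqP // | /eqP a0 | w0]; first by lia.
have: ~~ r132 0 a b.
  apply: av; rewrite -!cats1 -catA; apply: (@cat_subseq _ [:: 0]) => //.
  by rewrite sub1seq.
rewrite /r132; lia.
Qed.

(** By [last_min] the final letter is 0; deleting it and lowering the others by one inverts the map
    on the right. The shorter word is nonempty, so appending 0 does create a descent. *)
Lemma words_ends_desc n :
  perm_eq [seq w <- words n.+2 | ends_desc w]
    [seq rcons (map (addn 1) w) 0 | w <- words n.+1].
Proof.
have pos u : all (ltn 0) (map (addn 1) u) by apply/allP => _ /mapP[a _ ->].
apply: uniq_perm.
- exact/filter_uniq/words_uniq.
- rewrite map_inj_uniq ?words_uniq // => u v /rcons_inj[].
  exact/inj_map/addnI.
move=> w; rewrite mem_filter mem_words; apply/and3P/mapP.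
  case=> dw vw pw.
  have [|u [a [b w_def]]] := @seq_rcons2P _ w.
    by rewrite (perm_size pw) size_iota.
  move: dw vw pw; rewrite w_def ends_with_rcons2 => ba vw pw.
  have b0 : b = 0 by case/andP: (vw) => av _; exact: last_min pw av ba.
  rewrite {}b0 {b ba w_def} in vw pw *.
  move: (rcons u a) vw pw => {w u a} w vw.
  rewrite -[n.+2]/(1 + n.+1) iotaD perm_rcons perm_cons => pw.
  have w_def : w = map (addn 1) (map predn w).
    rewrite -map_comp map_id_in // => a; rewrite (perm_mem pw) mem_iota /=; lia.
  exists (map predn w); last by rewrite -w_def.
  rewrite w_def valid_rcons_min // valid_shift in vw.
  rewrite mem_words vw andTb.
  have -> : iota 0 n.+1 = map predn (iota (0 + 1) n.+1).
    by rewrite addnC iotaDl -map_comp map_id.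
  exact: perm_map.
case=> u; rewrite mem_words => /andP[vu pu] ->.
have u0 : u != [::] by apply: contraTneq pu => ->; apply/negP => /perm_size.
split; first by rewrite ends_desc_rcons_min //; case: (u) u0.
  by rewrite valid_rcons_min // valid_shift.
rewrite -[n.+2]/(1 + n.+1) iotaD perm_rcons perm_cons.
by rewrite addnC iotaDl perm_map.
Qed.

Lemma ends_asc_desc w : uniq w -> 1 < size w -> ~~ ends_asc w = ends_desc w.
Proof.
move=> Uw /seq_rcons2P[u [a [b w_def]]]; move: Uw.
rewrite w_def !ends_with_rcons2.
by rewrite rcons_uniq mem_rcons inE /=; case: ltngtP.
Qed.

(** * From permutations to their one-line words *)

Lemma word_perm n (s : 'S_n) : perm_eq (word s) (iota 0 n).
Proof.
rewrite -val_enum_ord /word map_comp; apply: perm_map; apply: uniq_perm.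
- by rewrite map_inj_uniq ?enum_uniq //; apply: perm_inj.
- exact: enum_uniq.
move=> i; rewrite mem_enum; apply/mapP; exists ((s^-1)%g i).
  by rewrite mem_enum.
by rewrite permKV.
Qed.

Lemma word_inj n : injective (@word n).
Proof.
move=> s1 s2 /eq_in_map eq_s; apply/permP => i; apply/val_inj/eq_s.
by rewrite mem_enum.
Qed.

Lemma perm_words_Sn n : perm_eq [seq word s | s : 'S_n] (permutations (iota 0 n)).
Proof.
have U : uniq [seq word s | s : 'S_n].
  by rewrite map_inj_uniq ?enum_uniq //; apply: word_inj.
apply: uniq_perm => //; first exact: permutations_uniq.
have sub : {subset [seq word s | s : 'S_n] <= permutations (iota 0 n)}.
  by move=> _ /mapP[s _ ->]; rewrite mem_permutations word_perm.
(* Both lists are duplicate-free with n! elements, so inclusion is enough. *)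
have [|_ //] := uniq_min_size U sub.
by rewrite size_permutations ?iota_uniq // size_iota size_map -cardE card_Sn.
Qed.

(** * Recurrences for the coefficients of F and G *)

Local Open Scope ring_scope.

Lemma F_213E n : F_213 n = \sum_(w <- words n) 'X ^+ occ3 r213 w.
Proof.
rewrite big_filter -(perm_big _ (perm_words_Sn n)) big_map big_enum_cond /=.
apply: eq_big => [s|s _]; first by rewrite inE validE.
by rewrite /occ_213 (occE _ _ order_iso_213).
Qed.

(* Weight of the block preceding the maximum: that maximum completes an
   occurrence of 213 exactly when the block ends in a descent. *)
Definition prefix_gf : fps {poly int} := fun n =>
  \sum_(w <- words n | ~~ ends_asc w) 'X ^+ (occ3 r213 w + ends_desc w).

(** With at least two distinct letters, not ending in an ascent means ending in a descent. Each word
    thus carries one extra factor t, and deleting its final minimum preserves the other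
    occurrences. *)
Lemma prefix_gfSS n : prefix_gf n.+2 = 'X * F_213 n.+1.
Proof.
transitivity (\sum_(w <- words n.+2 | ends_desc w)
    ('X ^+ (occ3 r213 w + 1) : {poly int})).
  rewrite /prefix_gf big_seq_cond [RHS]big_seq_cond.
  have E w : w \in words n.+2 -> ~~ ends_asc w = ends_desc w.
    rewrite mem_words => /andP[_ pw]; apply: ends_asc_desc.
      by rewrite (perm_uniq pw) iota_uniq.
    by rewrite (perm_size pw) size_iota.
  apply: eq_big => [w|w /andP[ww]]; first by case: (boolP (_ \in _)) => // /E.
  by rewrite E // => ->.
rewrite -big_filter (perm_big _ (words_ends_desc n)) big_map F_213E big_distrr /=.
apply: eq_bigr => w _; rewrite occ3_213_rcons_min ?occ3_213_shift ?addn1 ?exprS //.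
by apply/allP => _ /mapP[a _ ->].
Qed.

(** Words are grouped by the position [i] of their maximum. The exponent is additive over the two
    blocks, and the 213 completed by the maximum is charged to the left block through
    [prefix_gf]. *)
Lemma F_213S n :
  F_213 n.+1 = \sum_(i < n.+1) prefix_gf i * F_213 (n - i)%N.
Proof.
(* [inord] is faithful here: [n] occurs in each word, so its index is below [n.+1]. *)
rewrite F_213E (partition_big (fun w => inord (index n w) : 'I_n.+1) xpredT) //=.
apply: eq_bigr => i _; have le_in : (i <= n)%N by rewrite -ltnS.
transitivity (\sum_(w <- [seq w <- words n.+1 | index n w == i])
    ('X ^+ occ3 r213 w : {poly int})).
  rewrite big_filter big_seq_cond [RHS]big_seq_cond; apply: eq_bigl => w.
  case: (boolP (_ \in _)) => //=; rewrite mem_words => /andP[_ pw].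
  rewrite -val_eqE /= inordK // -[n.+1](size_iota 0) -(perm_size pw) index_mem.
  by rewrite (perm_mem pw) mem_iota /=.
rewrite (perm_big _ (words_index le_in)) big_allpairs_dep big_filter.
rewrite /prefix_gf big_distrl /= big_seq_cond [RHS]big_seq_cond.
apply: eq_bigr => A; rewrite mem_words => /andP[/andP[_ pA] _].
rewrite F_213E big_distrr /= big_seq_cond [RHS]big_seq_cond.
apply: eq_bigr => B; rewrite mem_words andbT => /andP[_ pB].
have sA : size A = i by rewrite (perm_size pA) size_iota.
move: le_in pA pB; rewrite -sA => le_in pA pB.
have [_ An Bn _] := glue_hyps le_in pA pB.
by rewrite occ3_213_cat_max // occ3_213_shift ends_desc_shift exprD.
Qed.

(** * Power series coefficients and the functional equations *)

Lemma fpsDE (R : comNzRingType) (f g : fps R) n : (f + g) n = f n + g n.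
Proof. by []. Qed.

Lemma fpsBE (R : comNzRingType) (f g : fps R) n : (f - g) n = f n - g n.
Proof. by []. Qed.

Lemma fps1E (R : comNzRingType) n : (1 : fps R) n = (n == 0%N)%:R.
Proof. by case: n. Qed.

Lemma fpsXE (R : comNzRingType) n : fpsX R n = (n == 1%N)%:R.
Proof. by []. Qed.

Lemma fpsXM0 (R : comNzRingType) (f : fps R) : (fpsX R * f) 0%N = 0.
Proof. by rewrite [LHS]big_ord1 mul0r. Qed.

Lemma fpsXMS (R : comNzRingType) (f : fps R) n : (fpsX R * f) n.+1 = f n.
Proof.
rewrite [LHS]big_ord_recl mul0r add0r big_ord_recl mul1r subSS subn0.
by rewrite big1 ?addr0 // => i _; rewrite mul0r.
Qed.

Lemma fpsCM (R : comNzRingType) (c : R) (f : fps R) n : (fpsC c * f) n = c * f n.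
Proof.
rewrite [LHS]big_ord_recl subn0 big1 ?addr0 // => i _; exact: mul0r.
Qed.

Lemma F_213_0 : F_213 0%N = 1.
Proof. by rewrite F_213E big_seq1. Qed.

Lemma F_213_rec : F_213 = 1 + fpsX _ * (prefix_gf * F_213).
Proof.
apply/funext => -[|n]; rewrite fpsDE fps1E.
  by rewrite fpsXM0 F_213_0 addr0.
by rewrite fpsXMS F_213S add0r.
Qed.

(** The empty word gives 1 and the one-letter word gives x. Longer words follow [prefix_gfSS], where
    F - 1 appears because the word left after deleting the minimum is nonempty. *)
Lemma prefix_gfE :
  prefix_gf = 1 + fpsX _ + fpsX _ * (fpsC 'X * (F_213 - 1)).
Proof.
apply/funext => -[|[|n]]; rewrite !fpsDE fps1E fpsXE ?fpsXM0 ?fpsXMS ?fpsCM.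
- by rewrite /prefix_gf (_ : words 0 = [:: [::]]) // big_mkcond big_seq1 !addr0.
- rewrite /prefix_gf (_ : words 1 = [:: [:: 0%N]]) // big_mkcond big_seq1.
  by rewrite fpsBE fps1E F_213_0 subrr mulr0 addr0 add0r.
- by rewrite prefix_gfSS fpsBE fps1E subr0 !add0r.
Qed.

Theorem theorem6p1 :
  let x : fps {poly int} := fpsX {poly int} in
  let t : fps {poly int} := fpsC 'X in
  let a : fps {poly int} := x ^+ 2 * t in
  let b : fps {poly int} := - 1 + x + x ^+ 2 - x ^+ 2 * t in
  a * F_213 ^+ 2 + b * F_213 + 1 = 0.
Proof.
move=> x t a b; rewrite /a /b.
have : F_213 - (1 + x * (prefix_gf * F_213)) = 0.
  by rewrite -F_213_rec subrr.
(* Substituting G in F - 1 - x G F = 0 gives the quadratic up to sign, whence the negation before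
   [ring]. *)
rewrite prefix_gfE -/x -/t => /(congr1 -%R); rewrite oppr0 => <-.
ring.
Qed.
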